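(* Let $k$ be a field and let $\varphi: C \to D$ be a morphism of $k$-coalgebras. The following statements are equivalent: \begin{enumerate} \item $\varphi$ is a monomorphism in the category of $k$-coalgebras; \item the corestriction functor $\varphi^{*}_{C,D}: \mathcal{M}^{C} \to \mathcal{M}^{D}$ is full; \item $C \square_{D} \operatorname{Ker}(\varphi) = 0$; \item the map $\Delta_C: C \to C \square_D C$, $c \mapsto c_{(1)} \otimes c_{(2)}$, is surjective (hence bijective); \item the unit $\eta: 1_{\mathcal{M}^C} \to (-\square_D C)\circ \varphi^{*}_{C,D}$ of the adjunction $(\varphi^{*}_{C,D}, -\square_D C)$ is a natural isomorphism; \item $H^{0}(N,C) = H^{0}(N,D)$ for every $(C,C)$-bicomodule $N$; \item $\sum_{i\in I} \varepsilon(a^{i}) b^{i} = \sum_{i \in I} a^{i}\varepsilon(b^{i})$ for every element $\sum_{i\in I} a^{i}\otimes b^{i} \in C \square_D C$. \end{enumerate}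
   Context: Sweedler notation: $\Delta(c)=c_{(1)}\otimes c_{(2)}$; for a right comodule $\rho^r_M(m)=m_{[0]}\otimes m_{[1]}$, for a left comodule $\rho^l_N(n)=n_{<-1>}\otimes n_{<0>}$. $\mathcal{M}^C$ denotes the category of right $C$-comodules. For a right $D$-comodule $M$ and left $D$-comodule $N$, the cotensor product $M\square_D N$ is the kernel of $\rho^r_M\otimes I - I\otimes \rho^l_N: M\otimes N\to M\otimes D\otimes N$. Via $\varphi$, every right (left) $C$-comodule $M$ becomes a right (left) $D$-comodule with coaction $m\mapsto m_{[0]}\otimes\varphi(m_{[1]})$ (resp. $m \mapsto \varphi(m_{<-1>})\otimes m_{<0>}$); the corestriction functor $\varphi^*_{C,D}:\mathcal{M}^C\to\mathcal{M}^D$ is this construction on right comodules (identity on morphisms). In particular $C$ is a $(D,D)$-bicomodule and a $(C,D)$-bicomodule, so $-\square_D C$ is a functor $\mathcal{M}^D\to\mathcal{M}^C$ (coinduction functor), right adjoint to $\varphi^*_{C,D}$, with unit $\eta_M=\rho^r_M: M\to M\square_D C$ for $M\in\mathcal{M}^C$. $\operatorname{Ker}(\varphi)$ is a left $D$-subcomodule of $C$ (with coaction $(\varphi\otimes I)\Delta_C$), and $C\square_D C$, $C\square_D\operatorname{Ker}(\varphi)$ are formed with these structures. For a coalgebra $E$ and an $(E,E)$-bicomodule $N$, $H^0(N,E)=\{\gamma\in N^* : n_{<-1>}\gamma(n_{<0>})=\gamma(n_{[0]})n_{[1]}\ \forall n\in N\}$; a $(C,C)$-bicomodule $N$ is regarded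 as a $(D,D)$-bicomodule via $\varphi$ to define $H^0(N,D)$. *)

(* Defs.v *)
(* Coalgebras, comodules and cotensor products over a field k.
   Tensor products are represented by finite formal sums (lists of pure
   tensors); two formal sums are identified in M (x) N iff they have the same
   image under every k-bilinear map M x N -> V (universal property of the
   tensor product).  Similarly for triple tensor products. *)
From HB Require Import structures.
From mathcomp Require Import all_boot all_algebra.
Set Implicit Arguments. Unset Strict Implicit. Unset Printing Implicit Defensive.
Import GRing.Theory.
Local Open Scope ring_scope.

Section Coalg.
Variable k : fieldType.

Definition linmap (M N : lmodType k) (f : M -> N) : Prop :=
  forall a x y, f (a *: x + y) = a *: f x + f y.
Definition linf (M : lmodType k) (f : M -> k) : Prop :=
  forall a x y, f (a *: x + y) = a * f x + f y.

Definition bilin (M N V : lmodType k) (b : M -> N -> V) : Prop :=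
  (forall n a m1 m2, b (a *: m1 + m2) n = a *: b m1 n + b m2 n) /\
  (forall m a n1 n2, b m (a *: n1 + n2) = a *: b m n1 + b m n2).

Definition trilin (M N P V : lmodType k) (b : M -> N -> P -> V) : Prop :=
  (forall n p a m1 m2, b (a *: m1 + m2) n p = a *: b m1 n p + b m2 n p) /\
  (forall m p a n1 n2, b m (a *: n1 + n2) p = a *: b m n1 p + b m n2 p) /\
  (forall m n a p1 p2, b m n (a *: p1 + p2) = a *: b m n p1 + b m n p2).

Definition teq2 (M N : lmodType k) (t s : seq (M * N)) : Prop :=
  forall (V : lmodType k) (b : M -> N -> V), bilin b ->
    \sum_(x <- t) b x.1 x.2 = \sum_(x <- s) b x.1 x.2.

Definition teq3 (M N P : lmodType k) (t s : seq (M * N * P)) : Prop :=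
  forall (V : lmodType k) (b : M -> N -> P -> V), trilin b ->
    \sum_(x <- t) b x.1.1 x.1.2 x.2 = \sum_(x <- s) b x.1.1 x.1.2 x.2.

Definition scale2 (M N : lmodType k) (a : k) (t : seq (M * N)) : seq (M * N) :=
  [seq (a *: x.1, x.2) | x <- t].

Definition map2 (A B A' B' : Type) (f : A -> A') (g : B -> B') (t : seq (A * B))
  : seq (A' * B') := [seq (f x.1, g x.2) | x <- t].

Definition lft (A A1 A2 B : Type) (f : A -> seq (A1 * A2)) (t : seq (A * B))
  : seq (A1 * A2 * B) :=
  flatten [seq [seq (y.1, y.2, x.2) | y <- f x.1] | x <- t].

Definition rgt (A B B1 B2 : Type) (f : B -> seq (B1 * B2)) (t : seq (A * B))
  : seq (A * B1 * B2) :=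
  flatten [seq [seq (x.1, y.1, y.2) | y <- f x.2] | x <- t].

Definition lin_up2 (M M1 M2 : lmodType k) (f : M -> seq (M1 * M2)) : Prop :=
  forall a x y, teq2 (f (a *: x + y)) (scale2 a (f x) ++ f y).

Record coalgebra := Coalgebra {
  coalg_sort :> lmodType k;
  cop : coalg_sort -> seq (coalg_sort * coalg_sort);
  cou : coalg_sort -> k;
  cop_lin : lin_up2 cop;
  cou_lin : linf cou;
  coassoc : forall c, teq3 (lft cop (cop c)) (rgt cop (cop c));
  counitl : forall c, \sum_(x <- cop c) cou x.1 *: x.2 = c;
  counitr : forall c, \sum_(x <- cop c) cou x.2 *: x.1 = c }.

Definition is_coalg_hom (C D : coalgebra) (f : C -> D) : Prop :=
  [/\ linmap f,
      forall c, teq2 (cop (f c)) (map2 f f (cop c)) &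
      forall c, cou (f c) = cou c].

Record rcomod (C : coalgebra) := RComod {
  rc_sort :> lmodType k;
  rco : rc_sort -> seq (rc_sort * C);
  rco_lin : lin_up2 rco;
  rco_assoc : forall m, teq3 (lft rco (rco m)) (rgt (@cop C) (rco m));
  rco_counit : forall m, \sum_(x <- rco m) cou x.2 *: x.1 = m }.

Record bicomod (C : coalgebra) := BiComod {
  bc_sort :> lmodType k;
  bl : bc_sort -> seq (C * bc_sort);
  br : bc_sort -> seq (bc_sort * C);
  bl_lin : lin_up2 bl;
  br_lin : lin_up2 br;
  bl_assoc : forall n, teq3 (rgt bl (bl n)) (lft (@cop C) (bl n));
  bl_counit : forall n, \sum_(x <- bl n) cou x.1 *: x.2 = n;
  br_assoc : forall n, teq3 (lft br (br n)) (rgt (@cop C) (br n));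
  br_counit : forall n, \sum_(x <- br n) cou x.2 *: x.1 = n;
  b_compat : forall n, teq3 (lft bl (br n)) (rgt br (bl n)) }.

Definition cotensor (M N D : lmodType k) (rM : M -> seq (M * D))
  (lN : N -> seq (D * N)) (t : seq (M * N)) : Prop :=
  teq3 (lft rM t) (rgt lN t).

End Coalg.

Definition rcoD (k : fieldType) (C D : coalgebra k) (phi : C -> D) (M : rcomod C)
  (m : M) : seq (M * D) := map2 id phi (rco m).
Definition CrD (k : fieldType) (C D : coalgebra k) (phi : C -> D) (c : C)
  : seq (C * D) := map2 id phi (cop c).
Definition ClD (k : fieldType) (C D : coalgebra k) (phi : C -> D) (c : C)
  : seq (D * C) := map2 phi id (cop c).

(* Main.v *)
(* Over a field, a finite sum of pure tensors is determined by its values on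
   pairs (triples) of linear forms, so the coalgebra and comodule axioms become
   identities in the dual algebra C^* (under convolution) acting on the dual
   spaces.  Via [ract] and [lact], t lies in M []_D C iff the action of
   D^* -> C^* can be moved from the left to the right factor of t.

   The chain is (1) => (6) => (7) => (5) => (2) => (1), together with
   (5) => (4) => (7) and (3) <=> (4).  For (1) => (6), a form gam on N yields
   the inner coderivation d : N -> C, and (c, n) |-> c and
   (c, n) |-> c + d n are two coalgebra maps on the trivial extension C (+) N;
   they agree after phi iff gam is in H^0(N, D).  For (6) => (7), take
   N = C []_D C and gam = eps (x) eps.  For (7) => (5), apply (7) to the
   contractions of rho_M(m_i) (x) c_i by all forms on M.  For (2) => (1),
   corestrict E along both maps and apply fullness to the identity of E. *)
Require Import Defs.
From HB Require Import structures.
From mathcomp Require Import all_boot all_algebra.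
From mathcomp Require Import boolp classical_sets functions.
Import GRing.Theory.
Local Open Scope ring_scope.
Set Implicit Arguments.
Unset Strict Implicit.
Unset Printing Implicit Defensive.

(** * Linear forms on a vector space and separation of points *)

Section LinearForms.
Variables (k : fieldType) (M : lmodType k).
Implicit Type f : M -> k.

Lemma linf0 f : linf f -> f 0 = 0.
Proof. by move=> lf; have := lf (-1) 0 0; rewrite scaler0 add0r mulN1r addNr. Qed.

Lemma linfD f : linf f -> {morph f : x y / x + y}.
Proof. by move=> lf x y; have := lf 1 x y; rewrite scale1r mul1r. Qed.

Lemma linfZ f a x : linf f -> f (a *: x) = a * f x.
Proof. by move=> lf; have := lf a x 0; rewrite (linf0 lf) !addr0. Qed.

Lemma linfN f x : linf f -> f (- x) = - f x.
Proof. by move=> lf; rewrite -scaleN1r linfZ // mulN1r. Qed.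

Lemma linfB f x y : linf f -> f (x - y) = f x - f y.
Proof. by move=> lf; rewrite linfD // linfN. Qed.

Lemma linf_sum f (I : Type) (r : seq I) (F : I -> M) : linf f ->
  f (\sum_(i <- r) F i) = \sum_(i <- r) f (F i).
Proof. by move=> lf; apply: big_morph; [exact: linfD|exact: linf0]. Qed.

(* A subspace maximal among those avoiding [v] is a complement of [k v]; the
   form is the coordinate along [v]. *)
Lemma exists_linf (v : M) : v != 0 -> exists2 f, linf f & f v = 1.
Proof.
move=> v0.
(* [P] admits the empty set, which is the union of the empty chain; hence the separate case [y = 0]
   below, until [A 0] is proved. *)
pose P (A : set M) := (forall a x y, A x -> A y -> A (a *: x + y)) /\ ~ A v.
have [|A [[Alin Av] Amax]] := @Zorn_bigcup _ P.
  move=> F FP Ftot; split=> [a x y [X FX Xx] [Y FY Yy]|[X FX Xv]]; last first.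
    exact: (FP _ FX).2.
  have [XY|YX] := Ftot _ _ FX FY.
    by exists Y => //; apply: (FP _ FY).1 => //; exact: XY.
  by exists X => //; apply: (FP _ FX).1 => //; exact: YX.
(* By maximality of [A], the span [B] of [x] and [A] must contain [v]. *)
have ext x : ~ A x -> exists a y, v = a *: x + y /\ (A y \/ y = 0).
  move=> Ax.
  pose B : set M := fun z => exists a y, z = a *: x + y /\ (A y \/ y = 0).
  apply: contrapT => nBv; apply: (Amax B); last first.
    split=> // a _ _ [b [y [-> Ay]]] [c [z [-> Az]]].
    exists (a * b + c), (a *: y + z); split.
      by rewrite scalerDr scalerDl scalerA addrACA.
    case: Ay Az => [Ay|->] [Az|->].
    - by left; exact: Alin.
    - have Ayy : A ((-1) *: y + y) by exact: Alin.
      rewrite scaleN1r addNr in Ayy.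
      by left; apply: Alin.
    - by left; rewrite scaler0 add0r.
    - by right; rewrite scaler0 add0r.
  split; last first.
    by move=> BA; apply: Ax; apply: BA; exists 1, 0; rewrite scale1r addr0; split=> //; right.
  by move=> y Ay; exists 0, y; rewrite scale0r add0r; split=> //; left.
have A0 : A 0.
  apply: contrapT => /ext[a [y [+ [Ay|y0]]]]; rewrite scaler0 add0r => vy.
    by apply: Av; rewrite vy.
  by move: v0; rewrite vy y0 eqxx.
have AZ a x : A x -> A (a *: x) by move=> Ax; rewrite -[_ *: _]addr0; exact: Alin.
have coord x : exists a, A (x - a *: v).
  have [Ax|/ext[a [y [vE Ay]]]] := pselect (A x).
    by exists 0; rewrite scale0r subr0.
  have {}Ay : A y by case: Ay => [//|->].
  have a0 : a != 0.
    by apply/eqP => a0; apply: Av; rewrite vE a0 scale0r add0r.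
  exists a^-1; rewrite vE scalerDr scalerA mulVf // scale1r opprD addrA subrr.
  by rewrite add0r -scaleNr; exact: AZ.
have uniq_coord x a b : A (x - a *: v) -> A (x - b *: v) -> a = b.
  move=> Aa Ab; apply: subr0_eq; have [//|ab0] := eqVneq (a - b) 0.
  case: Av; have := AZ (a - b)^-1 _ (Alin (-1) _ _ Aa Ab).
  rewrite scaleN1r opprB addrA subrK -scalerBl scalerA mulVf //.
  by rewrite scale1r.
have [f fP] := choice coord.
exists f; last by apply: (uniq_coord v) => //; rewrite scale1r subrr.
move=> a x y; apply: (uniq_coord (a *: x + y)) => //.
by rewrite scalerDl opprD addrACA -scalerA -scalerBr; exact: Alin.
Qed.

End LinearForms.

(** * Bundled linear forms and finite coordinate systems *)

Record dual (k : fieldType) (M : lmodType k) :=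
  Dual { dual_fun :> M -> k; dualP : linf dual_fun }.

Section Dual.
Variables (k : fieldType) (M : lmodType k).
Implicit Types f g : dual M.

Lemma dual_eq f g : f =1 g -> f = g.
Proof.
case: f g => [f lf] [g lg] /= /funext fg; rewrite fg in lf *.
by congr Dual; exact: Prop_irrelevance.
Qed.

Lemma dual0 f : f 0 = 0.
Proof. exact: linf0 (dualP f). Qed.

Lemma dualD f : {morph f : x y / x + y}.
Proof. exact: linfD (dualP f). Qed.

Lemma dualZ f a x : f (a *: x) = a * f x.
Proof. exact: linfZ (dualP f). Qed.

Lemma dualB f x y : f (x - y) = f x - f y.
Proof. exact: linfB (dualP f). Qed.

Lemma dual_sum f (I : Type) (r : seq I) (F : I -> M) :
  f (\sum_(i <- r) F i) = \sum_(i <- r) f (F i).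
Proof. exact: linf_sum (dualP f). Qed.

Lemma exists_dual (v : M) : v != 0 -> exists f : dual M, f v = 1.
Proof. by move=> /exists_linf[f lf fv]; exists (Dual lf). Qed.

Lemma dual_inj (x y : M) : (forall f : dual M, f x = f y) -> x = y.
Proof.
move=> fxy; apply: subr0_eq; have [//|/exists_dual[f]] := eqVneq (x - y) 0.
by rewrite dualB fxy subrr => /eqP; rewrite eq_sym oner_eq0.
Qed.

(* The projection [P v = \sum_e e.2 v *: e.1] onto the span of a list extends
   to one more vector [a] by adding [f (v - P v) *: (a - P a)], where
   [f (a - P a) = 1]. *)
Lemma finite_coords (r : seq M) : exists s : seq (M * dual M),
  {in r, forall x, x = \sum_(e <- s) e.2 x *: e.1}.
Proof.
elim: r => [|a r [s sP]]; first by exists [::].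
pose P v := \sum_(e <- s) (e.2 : dual M) v *: e.1.
have [aPa|/exists_dual[f fa]] := eqVneq (a - P a) 0.
  exists s => x /predU1P[->|/sP//]; exact: subr0_eq.
have lP b x y : P (b *: x + y) = b *: P x + P y.
  rewrite /P scaler_sumr -big_split; apply: eq_bigr => e _ /=.
  by rewrite (dualP e.2) scalerDl -scalerA.
have lg : linf (fun v => f (v - P v)).
  move=> b x y; rewrite -(dualP f); congr (f _).
  by rewrite lP scalerBr opprD addrACA.
exists ((a - P a, Dual lg) :: s) => x; rewrite inE big_cons /=.
move=> /predU1P[->|/sP xE]; first by rewrite fa scale1r subrK.
by rewrite -/(P x) -[P x]xE subrr (linf0 (dualP f)) scale0r add0r.
Qed.

End Dual.

(** * Tensors and linear forms *)

Section Tensor.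
Variable k : fieldType.
Implicit Types M N P V : lmodType k.

Definition ev2 M N (f : M -> k) (g : N -> k) (t : seq (M * N)) : k :=
  \sum_(x <- t) f x.1 * g x.2.

Definition ev3 M N P (f : M -> k) (g : N -> k) (h : P -> k)
    (t : seq (M * N * P)) : k :=
  \sum_(x <- t) f x.1.1 * g x.1.2 * h x.2.

Definition contractl M N (f : M -> k) (t : seq (M * N)) : N :=
  \sum_(x <- t) f x.1 *: x.2.

Definition contractr M N (g : N -> k) (t : seq (M * N)) : M :=
  \sum_(x <- t) g x.2 *: x.1.

Lemma linmapD M N (f : M -> N) : linmap f -> {morph f : x y / x + y}.
Proof. by move=> lf x y; rewrite -[x in LHS]scale1r lf scale1r. Qed.

Lemma linmap0 M N (f : M -> N) : linmap f -> f 0 = 0.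
Proof. by move=> lf; have := lf (-1) 0 0; rewrite scaler0 add0r scaleN1r addNr. Qed.

Lemma linmapZ M N (f : M -> N) a x : linmap f -> f (a *: x) = a *: f x.
Proof. by move=> lf; have := lf a x 0; rewrite (linmap0 lf) !addr0. Qed.

Lemma linmap_sum M N (f : M -> N) (I : Type) (r : seq I) (F : I -> M) :
  linmap f -> f (\sum_(i <- r) F i) = \sum_(i <- r) f (F i).
Proof. by move=> lf; apply: big_morph; [exact: linmapD|exact: linmap0]. Qed.

Lemma bilin_linmapl M N V (b : M -> N -> V) n : bilin b -> linmap (b^~ n).
Proof. by case=> + _ a x y; exact. Qed.

Lemma bilin_linmapr M N V (b : M -> N -> V) m : bilin b -> linmap (b m).
Proof. by case=> _ + a x y; exact. Qed.

Lemma bilin_dual M N (f : dual M) (g : dual N) :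
  bilin (fun m n => f m * g n : k^o).
Proof.
split=> [n a x y|m a x y].
  by rewrite (dualP f) mulrDl -mulrA.
by rewrite (dualP g) mulrDr mulrCA.
Qed.

Lemma trilin_dual M N P (f : dual M) (g : dual N) (h : dual P) :
  trilin (fun m n p => f m * g n * h p : k^o).
Proof.
split=> [n p a x y|]; first by rewrite (dualP f) !mulrDl -!mulrA.
split=> [m p a x y|m n a x y].
  by rewrite (dualP g) mulrDr mulrDl mulrCA -!mulrA.
by rewrite (dualP h) mulrDr mulrCA.
Qed.

Lemma teq2_ev M N (t s : seq (M * N)) (f : dual M) (g : dual N) :
  teq2 t s -> ev2 f g t = ev2 f g s.
Proof. by move=> ts; exact: ts (bilin_dual f g). Qed.

Lemma teq3_ev M N P (t s : seq (M * N * P)) (f : dual M) (g : dual N)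
  (h : dual P) : teq3 t s -> ev3 f g h t = ev3 f g h s.
Proof. by move=> ts; exact: ts (trilin_dual f g h). Qed.

Lemma dual_contractl M N (f : M -> k) (g : dual N) t :
  g (contractl f t) = ev2 f g t.
Proof. by rewrite dual_sum; apply: eq_bigr => x _; rewrite dualZ. Qed.

Lemma dual_contractr M N (f : dual M) (g : N -> k) t :
  f (contractr g t) = ev2 f g t.
Proof. by rewrite dual_sum; apply: eq_bigr => x _; rewrite dualZ mulrC. Qed.

(** Expanding the left factors and moving the scalars across [b] gathers the right factors into one
    contraction per coordinate, so [b] sees [t] only through its contractions by forms. *)
Lemma bilin_coords M N V (b : M -> N -> V) s t : bilin b ->
    {in unzip1 t, forall x, x = \sum_(e <- s) (e.2 : dual M) x *: e.1} ->
  \sum_(x <- t) b x.1 x.2 = \sum_(e <- s) b e.1 (contractl e.2 t).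
Proof.
move=> bb sP; under [RHS]eq_bigr => e _.
  rewrite (linmap_sum _ _ (bilin_linmapr _ bb)).
  under eq_bigr => x _.
    rewrite (linmapZ _ _ (bilin_linmapr _ bb)).
    rewrite -(linmapZ _ _ (bilin_linmapl _ bb)).
  over.
over.
rewrite exchange_big /=; apply: eq_big_seq => x xt.
by rewrite -(linmap_sum _ _ (bilin_linmapl _ bb)) -sP // map_f.
Qed.

(** Serves to show that a tensor killed by [I (x) phi] has a representative whose right factors all
    lie in the kernel of [phi]. *)
Lemma contractl_repr M N (t : seq (M * N)) : exists s : seq (M * dual M),
  teq2 t [seq (e.1, contractl (e.2 : dual M) t) | e <- s].
Proof.
have [s sP] := finite_coords (unzip1 t); exists s => V b bb.
by rewrite big_map (bilin_coords bb sP).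
Qed.

(** In coordinates common to [t] and [s] the two sums compare term by term, and forms on [N]
    separate the contractions. *)
Lemma teq2P M N (t s : seq (M * N)) :
  (forall (f : dual M) (g : dual N), ev2 f g t = ev2 f g s) -> teq2 t s.
Proof.
move=> ts V b bb.
have [r rP] := finite_coords (unzip1 t ++ unzip1 s).
rewrite !(bilin_coords bb (s := r)); last 2 first.
- by move=> x xs; apply: rP; rewrite mem_cat xs orbT.
- by move=> x xt; apply: rP; rewrite mem_cat xt.
apply: eq_bigr => e _; congr (b _ _); apply: dual_inj => g.
by rewrite !dual_contractl ts.
Qed.

Lemma teq3P M N P (t s : seq (M * N * P)) :
  (forall (f : dual M) (g : dual N) (h : dual P), ev3 f g h t = ev3 f g h s) ->
  teq3 t s.
Proof.
move=> ts V b [b1 [b2 b3]].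
have [r rP] := finite_coords (unzip2 t ++ unzip2 s).
have lb m n : linmap (b m n) by move=> a x y; exact: b3.
have lbl n p : linmap (fun m => b m n p) by move=> a x y; exact: b1.
have bb p : bilin (fun m n => b m n p).
  by split=> *; [exact: b1|exact: b2].
have expand u : {subset unzip2 u <= unzip2 t ++ unzip2 s} ->
    \sum_(x <- u) b x.1.1 x.1.2 x.2 =
    \sum_(e <- r) \sum_(y <- [seq (e.2 x.2 *: x.1.1, x.1.2) | x <- u])
      b y.1 y.2 e.1.
  move=> sub; under [RHS]eq_bigr do rewrite big_map /=.
  rewrite exchange_big /=; apply: eq_big_seq => x xu.
  rewrite {1}[x.2]rP ?sub ?map_f // (linmap_sum _ _ (lb _ _)).
  by apply: eq_bigr => e _; rewrite (linmapZ _ _ (lb _ _)) (linmapZ _ _ (lbl _ _)).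
rewrite !expand; last 2 first.
- by move=> x xs; rewrite mem_cat xs orbT.
- by move=> x xt; rewrite mem_cat xt.
apply: eq_bigr => -[e h] _ /=.
(* Contraction of the third factor by [h], with the scalar stored in the first factor; this reduces
   the claim to [teq2P]. *)
pose l u := [seq (h x.2 *: x.1.1, x.1.2) | x : M * N * P <- u].
suff lts : teq2 (l t) (l s) by exact: lts _ _ (bb e).
apply: teq2P => f g.
have ev u : ev2 f g (l u) = ev3 f g h u.
  rewrite /ev2 /ev3 big_map; apply: eq_bigr => x _ /=.
  by rewrite dualZ [RHS]mulrC mulrA.
by rewrite !ev.
Qed.

End Tensor.

(** * Calculus of evaluations on pairs and triples of forms *)

Section Ev.
Variable k : fieldType.
Implicit Types M N P Q : lmodType k.

Lemma ev2_cat M N (f : M -> k) (g : N -> k) t s :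
  ev2 f g (t ++ s) = ev2 f g t + ev2 f g s.
Proof. exact: big_cat. Qed.

Lemma ev2_scale2 M N (f : dual M) (g : N -> k) a t :
  ev2 f g (scale2 a t) = a * ev2 f g t.
Proof.
rewrite /ev2 big_map mulr_sumr; apply: eq_bigr => x _ /=.
by rewrite dualZ mulrA.
Qed.

Lemma ev2_map2 M N M' N' (a : M -> M') (b : N -> N') (f : M' -> k)
  (g : N' -> k) t : ev2 f g (map2 a b t) = ev2 (f \o a) (g \o b) t.
Proof. exact: big_map. Qed.

Lemma eq_ev2 M N (f f' : M -> k) (g g' : N -> k) t :
  f =1 f' -> g =1 g' -> ev2 f g t = ev2 f' g' t.
Proof. by move=> ff gg; apply: eq_bigr => x _; rewrite ff gg. Qed.

Lemma ev2_nil M N (f : M -> k) (g : N -> k) : ev2 f g [::] = 0.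
Proof. exact: big_nil. Qed.

Lemma ev2Dr M N (f : M -> k) (g h : N -> k) t :
  ev2 f (fun x => g x + h x) t = ev2 f g t + ev2 f h t.
Proof. by rewrite /ev2 -big_split; apply: eq_bigr => x _; rewrite mulrDr. Qed.

Lemma ev2Dl M N (f g : M -> k) (h : N -> k) t :
  ev2 (fun x => f x + g x) h t = ev2 f h t + ev2 g h t.
Proof. by rewrite /ev2 -big_split; apply: eq_bigr => x _; rewrite mulrDl. Qed.

Lemma ev2Br M N (f : M -> k) (g h : N -> k) t :
  ev2 f (fun x => g x - h x) t = ev2 f g t - ev2 f h t.
Proof. by rewrite /ev2 -sumrB; apply: eq_bigr => x _; rewrite mulrBr. Qed.

Lemma ev2Bl M N (f g : M -> k) (h : N -> k) t :
  ev2 (fun x => f x - g x) h t = ev2 f h t - ev2 g h t.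
Proof. by rewrite /ev2 -sumrB; apply: eq_bigr => x _; rewrite mulrBl. Qed.

Lemma ev3_lft M N P Q (r : Q -> seq (M * N)) (f : M -> k) (g : N -> k)
    (h : P -> k) t :
  ev3 f g h (lft r t) = ev2 (fun x => ev2 f g (r x)) h t.
Proof.
rewrite /ev3 /lft big_flatten big_map; apply: eq_bigr => x _ /=.
by rewrite big_map /ev2 mulr_suml.
Qed.

Lemma ev3_rgt M N P Q (r : Q -> seq (N * P)) (f : M -> k) (g : N -> k)
    (h : P -> k) t :
  ev3 f g h (rgt r t) = ev2 f (fun x => ev2 g h (r x)) t.
Proof.
rewrite /ev3 /rgt big_flatten big_map; apply: eq_bigr => x _ /=.
by rewrite big_map /ev2 mulr_sumr; apply: eq_bigr => y _; rewrite mulrA.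
Qed.

Lemma ev2_coords M N (f : dual M) (g : dual N) s t :
    {in unzip1 t, forall x, x = \sum_(e <- s) (e.2 : dual M) x *: e.1} ->
  ev2 f g t = \sum_(e <- s) f e.1 * ev2 (e.2 : dual M) g t.
Proof.
move=> sP; apply: etrans (bilin_coords (bilin_dual f g) sP) _.
by apply: eq_bigr => e _; rewrite dual_contractl.
Qed.

Lemma linf_lin_up2 M N P (r : P -> seq (M * N)) (f : dual M) (g : dual N) :
  lin_up2 r -> linf (fun x => ev2 f g (r x)).
Proof. by move=> lr a x y; rewrite (teq2_ev f g (lr a x y)) ev2_cat ev2_scale2. Qed.

Lemma lin_up2P M N P (r : P -> seq (M * N)) :
  (forall (f : dual M) (g : dual N), linf (fun x => ev2 f g (r x))) -> lin_up2 r.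
Proof. by move=> lr a x y; apply: teq2P => f g; rewrite lr ev2_cat ev2_scale2. Qed.

Lemma linf_comp M N (h : M -> N) (f : dual N) : linmap h -> linf (f \o h).
Proof. by move=> lh a x y /=; rewrite lh (dualP f). Qed.

End Ev.

Definition pullback (k : fieldType) (M N : lmodType k) (h : M -> N)
  (lh : linmap h) (f : dual N) : dual M := Dual (linf_comp f lh).

(** * The dual algebra and its actions *)

Section DualAlgebra.
Variables (k : fieldType) (C : coalgebra k).
Implicit Types f g h : dual C.

Definition eps : dual C := Dual (@cou_lin _ C).

Definition conv f g : dual C := Dual (linf_lin_up2 f g (@cop_lin _ C)).

Lemma convE f g c : conv f g c = ev2 f g (cop c).
Proof. by []. Qed.

Lemma convA f g h : conv (conv f g) h = conv f (conv g h).
Proof.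
apply: dual_eq => c; rewrite !convE.
by have := teq3_ev f g h (coassoc c); rewrite ev3_lft ev3_rgt.
Qed.

Lemma conv_epsl f : conv eps f = f.
Proof. by apply: dual_eq => c; rewrite convE -dual_contractl [contractl _ _]counitl. Qed.

Lemma conv_epsr f : conv f eps = f.
Proof. by apply: dual_eq => c; rewrite convE -dual_contractr [contractr _ _]counitr. Qed.

Definition regular : rcomod C :=
  RComod (@cop_lin _ C) (@coassoc _ C) (@counitr _ C).

Section RightComodule.
Variable M : rcomod C.
Implicit Type m : dual M.

(** The right module structure over the dual algebra of [C] that the coaction induces on the dual
    space of [M]. *)
Definition ract m f : dual M := Dual (linf_lin_up2 m f (@rco_lin _ _ M)).

Lemma ractE m f x : ract m f x = ev2 m f (rco x).
Proof. by []. Qed.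

Lemma ractA m f g : ract (ract m f) g = ract m (conv f g).
Proof.
apply: dual_eq => c; rewrite !ractE.
by have := teq3_ev m f g (rco_assoc c); rewrite ev3_lft ev3_rgt.
Qed.

Lemma ract_eps m : ract m eps = m.
Proof. by apply: dual_eq => c; rewrite ractE -dual_contractr [contractr _ _]rco_counit. Qed.

End RightComodule.
End DualAlgebra.

Arguments eps {k C}.

Lemma hom_linmap (k : fieldType) (C D : coalgebra k) (phi : C -> D) :
  is_coalg_hom phi -> linmap phi.
Proof. by case. Qed.

(** * The seven conditions, and the implications provable from the cotensor criterion alone *)

Section CoalgebraMorphism.
Variables (k : fieldType) (C D : coalgebra k) (phi : C -> D).
Hypothesis hphi : is_coalg_hom phi.

Local Notation "f ^phi" := (pullback (hom_linmap hphi) f)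
  (at level 2, format "f ^phi").

Lemma pullback_conv (f g : dual D) : (conv f g)^phi = conv f^phi g^phi.
Proof.
have [_ hcop _] := hphi; apply: dual_eq => c.
by rewrite /= (teq2_ev f g (hcop c)) ev2_map2.
Qed.

Lemma pullback_eps : eps^phi = eps.
Proof. by have [_ _ hcou] := hphi; apply: dual_eq => c; exact: hcou. Qed.

Lemma cotensorP (M : rcomod C) (t : seq (M * C)) :
  cotensor (@rcoD _ _ _ phi M) (ClD phi) t <->
  forall (m : dual M) (f : dual D) (g : dual C),
    ev2 (ract m f^phi) g t = ev2 m (conv f^phi g) t.
Proof.
have evE (m : dual M) (f : dual D) (g : dual C) :
    (ev3 m f g (lft (@rcoD _ _ _ phi M) t) = ev2 (ract m f^phi) g t) *
    (ev3 m f g (rgt (ClD phi) t) = ev2 m (conv f^phi g) t).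
  by split; rewrite ?ev3_lft ?ev3_rgt; apply: eq_ev2 => // x; rewrite ev2_map2.
split=> [ct m f g|ct]; first by have := teq3_ev m f g ct; rewrite !evE.
by apply: teq3P => m f g; rewrite !evE.
Qed.

Lemma cotensor_regularP (t : seq (C * C)) :
  cotensor (CrD phi) (ClD phi) t <->
  forall (f : dual C) (g : dual D) (h : dual C),
    ev2 (conv f g^phi) h t = ev2 f (conv g^phi h) t.
Proof. exact: (cotensorP (M := regular C)). Qed.

Lemma cotensor_teq (t s : seq (C * C)) : teq2 t s ->
  cotensor (CrD phi) (ClD phi) t -> cotensor (CrD phi) (ClD phi) s.
Proof.
move=> ts /cotensor_regularP ct; apply/cotensor_regularP => f g h.
by rewrite -!(teq2_ev _ _ ts).
Qed.

Definition monomorphism := forall (E : coalgebra k) (f g : E -> C),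
  is_coalg_hom f -> is_coalg_hom g ->
  (forall e, phi (f e) = phi (g e)) -> forall e, f e = g e.

(** Corestriction is the identity on morphisms, so fullness means that colinearity over [D] forces
    colinearity over [C]. *)
Definition full_corestriction := forall (M N : rcomod C) (f : M -> N),
  linmap f ->
  (forall m, teq2 (@rcoD _ _ _ phi N (f m)) (map2 f id (@rcoD _ _ _ phi M m))) ->
  forall m, teq2 (rco (f m)) (map2 f id (rco m)).

(** Over a field, [C (x) Ker phi] embeds in [C (x) C], so both the cotensor condition and vanishing
    can be tested with right factors in [C]. *)
Definition trivial_cotensor_ker := forall t : seq (C * C),
  all (fun x => phi x.2 == 0) t -> cotensor (CrD phi) (ClD phi) t -> teq2 t [::].

Definition surjective_cop := forall t : seq (C * C),
  cotensor (CrD phi) (ClD phi) t -> exists c : C, teq2 (cop c) t.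

Definition iso_unit := forall M : rcomod C,
  (forall m m' : M, teq2 (rco m) (rco m') -> m = m') /\
  (forall t : seq (M * C), cotensor (@rcoD _ _ _ phi M) (ClD phi) t ->
     exists m : M, teq2 (rco m) t).

Definition same_H0 := forall (N : bicomod C) (gam : N -> k), linf gam ->
  ((forall n : N, \sum_(x <- bl n) gam x.2 *: x.1
                  = \sum_(x <- br n) gam x.1 *: x.2) <->
   (forall n : N, \sum_(x <- bl n) gam x.2 *: phi x.1
                  = \sum_(x <- br n) gam x.1 *: phi x.2)).

Definition symmetric_counit := forall t : seq (C * C),
  cotensor (CrD phi) (ClD phi) t ->
  \sum_(x <- t) cou x.1 *: x.2 = \sum_(x <- t) cou x.2 *: x.1.

Lemma rco_inj (M : rcomod C) (m m' : M) : teq2 (rco m) (rco m') -> m = m'.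
Proof.
move=> mm'; apply: dual_inj => f.
by rewrite -(ract_eps f) !ractE; exact: teq2_ev.
Qed.

Lemma symmetric_counit_iso_unit : symmetric_counit -> iso_unit.
Proof.
move=> sym M; split=> [|t /cotensorP ct]; first exact: rco_inj.
(* The only candidate: the counit applied to the second factor of [rco m] gives back [m]. *)
exists (contractr eps t); apply: teq2P => m f.
pose tm := map2 (fun x : M => contractl m (rco x)) id t.
have evtm (g h : dual C) : ev2 g h tm = ev2 (ract m g) h t.
  by rewrite ev2_map2; apply: eq_ev2 => // x /=; rewrite dual_contractl.
have ctm : cotensor (CrD phi) (ClD phi) tm.
  by apply/cotensor_regularP => g h l; rewrite !evtm -ractA ct.
(* For [tm], condition (7) becomes [ev2 m f t = ev2 (ract m f) eps t], whose right side is the value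
   of [m (x) f] on the coaction of the candidate. *)
have := congr1 f (sym _ ctm).
rewrite [f _](dual_contractl eps f) [f _](dual_contractr f eps) !evtm ract_eps => ->.
by rewrite -ractE dual_contractr.
Qed.

Lemma iso_unit_surjective_cop : iso_unit -> surjective_cop.
Proof. by move=> iso t; exact: (iso (regular C)).2. Qed.

Lemma surjective_cop_symmetric_counit : surjective_cop -> symmetric_counit.
Proof.
move=> surj t /surj[c ct]; apply: dual_inj => f.
rewrite [LHS](dual_contractl eps f) [RHS](dual_contractr f eps).
by rewrite -!(teq2_ev _ _ ct) -!convE conv_epsl conv_epsr.
Qed.

(** If [t] is the coproduct of [c], then [c] is recovered by applying [eps] to the right factors,
    and [eps] factors through [phi], which kills them. *)
Lemma surjective_cop_trivial_cotensor_ker : surjective_cop -> trivial_cotensor_ker.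
Proof.
move=> surj t kt /surj[c ct].
have c0 : c = 0.
  apply: dual_inj => f; rewrite -(conv_epsr f) convE (teq2_ev _ _ ct) dual0.
  rewrite /ev2 big_seq big1 // => x /(allP kt) /eqP phix.
  by rewrite -pullback_eps /= phix linf0 ?mulr0 //; exact: cou_lin.
by apply: teq2P => f g; rewrite -(teq2_ev _ _ ct) c0 ev2_nil -convE dual0.
Qed.

(* For [t] in [C []_D C] the difference [t - Delta (sum a * eps b)] is killed
   by [I (x) phi], hence lies in [C []_D Ker phi]. *)
Lemma trivial_cotensor_ker_surjective_cop : trivial_cotensor_ker -> surjective_cop.
Proof.
move=> triv t ct; have /cotensor_regularP ctE := ct.
pose c := contractr eps t; exists c.
pose u := t ++ scale2 (-1) (cop c).
have evu (f g : dual C) : ev2 f g u = ev2 f g t - conv f g c.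
  by rewrite ev2_cat ev2_scale2 mulN1r.
have [s us] := contractl_repr u.
have phi0 e : phi (contractl (e : dual C) u) == 0.
  (* The cotensor condition moves [f^phi] next to [eps] in the second factor, where the counit law
     makes the two parts of [u] cancel. *)
  apply/eqP/dual_inj => f; rewrite dual0 -[LHS]/(f^phi _) dual_contractl evu.
  by rewrite dual_contractr ctE conv_epsr subrr.
have s0 : teq2 [seq (e.1, contractl (e.2 : dual C) u) | e <- s] [::].
  apply: triv; first by rewrite all_map; elim: (s) => //= e l ->; rewrite phi0.
  apply: cotensor_teq us _; apply/cotensor_regularP => f g h.
  by rewrite !evu ctE convA.
apply: teq2P => f g; apply/esym/subr0_eq; rewrite -convE -evu.
by rewrite (teq2_ev f g us) (teq2_ev f g s0) ev2_nil.
Qed.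

(** Colinearity over [D] puts the image of [rco m] under [f (x) I] in the cotensor product, so it
    equals [rco n] for some [n]; the counit then gives [n = f m]. *)
Lemma iso_unit_full_corestriction : iso_unit -> full_corestriction.
Proof.
move=> iso M N f lf fD m.
have fDE (n : dual N) (g : dual D) :
    pullback lf (ract n g^phi) = ract (pullback lf n) g^phi.
  by apply: dual_eq => x; have := teq2_ev n g (fD x); rewrite !ev2_map2.
have evf (n : dual N) (g : dual C) :
    ev2 n g (map2 f id (rco m)) = ract (pullback lf n) g m.
  by rewrite ev2_map2.
have [n nE] : exists n, teq2 (rco n) (map2 f id (rco m)).
  by apply: (iso N).2; apply/cotensorP => n g h; rewrite !evf fDE ractA.
suff -> : f m = n by [].
apply: dual_inj => g; rewrite -[in RHS](ract_eps g) ractE (teq2_ev _ _ nE) evf.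
by rewrite ract_eps.
Qed.

End CoalgebraMorphism.

(** * A coalgebra as a comodule along a coalgebra map, and (2) => (1) *)

Section Corestriction.
Variables (k : fieldType) (E C : coalgebra k) (f : E -> C).
Hypothesis hf : is_coalg_hom f.

Let rho (e : E) : seq (E * C) := map2 id f (cop e).

Let rhoE (a : dual E) (b : dual C) e :
  ev2 a b (rho e) = conv a (pullback (hom_linmap hf) b) e.
Proof. by rewrite ev2_map2. Qed.

Let rho_lin : lin_up2 rho.
Proof. by apply: lin_up2P => a b c x y; rewrite !rhoE; exact: dualP. Qed.

Let rho_assoc e : teq3 (lft rho (rho e)) (rgt (@cop _ C) (rho e)).
Proof.
apply: teq3P => a b c; rewrite ev3_lft ev3_rgt.
rewrite (eq_ev2 _ (fun x => rhoE a b x) (frefl c)) rhoE.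
rewrite -[X in _ = ev2 _ X _]/(dual_fun (conv b c)).
by rewrite rhoE convA -pullback_conv.
Qed.

Let rho_counit e : \sum_(x <- rho e) cou x.2 *: x.1 = e.
Proof.
apply: dual_inj => a; rewrite [LHS](dual_contractr a eps) rhoE.
by rewrite pullback_eps conv_epsr.
Qed.

Definition corestriction : rcomod C := RComod rho_lin rho_assoc rho_counit.

End Corestriction.

Lemma full_corestriction_mono (k : fieldType) (C D : coalgebra k)
  (phi : C -> D) : full_corestriction phi -> monomorphism phi.
Proof.
move=> full E f g hf hg fg e; apply: dual_inj => a.
have lid : linmap (id : corestriction hf -> corestriction hg) by [].
have fD m : teq2 (@rcoD _ _ _ phi (corestriction hg) m)
    (map2 id id (@rcoD _ _ _ phi (corestriction hf) m)).
  apply: teq2P => b c; rewrite /rcoD !ev2_map2.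
  by apply: eq_ev2 => // x /=; rewrite fg.
(* Applying [eps (x) a] to the colinearity of the identity leaves [a (g e)] on one side and
   [a (f e)] on the other. *)
have := teq2_ev eps a (full _ _ _ lid fD e); rewrite !ev2_map2.
suff convE h (hh : is_coalg_hom h) : ev2 eps (a \o h) (cop e) = a (h e).
  by rewrite [LHS](convE g hg) [RHS](convE f hf).
pose F := pullback (hom_linmap hh) a.
by rewrite -[LHS]/(conv eps F e) conv_epsl.
Qed.

(** * The dual space of a bicomodule as a bimodule over the dual algebra *)

Section Bicomodule.
Variables (k : fieldType) (C : coalgebra k) (N : bicomod C).

Definition right_comod : rcomod C :=
  RComod (@br_lin _ _ N) (@br_assoc _ _ N) (@br_counit _ _ N).

Definition lact (f : dual C) (v : dual N) : dual N :=
  Dual (linf_lin_up2 f v (@bl_lin _ _ N)).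

Definition bract (v : dual N) (f : dual C) : dual N :=
  ract (M := right_comod) v f.

Lemma lactE f v n : lact f v n = ev2 f v (bl n).
Proof. by []. Qed.

Lemma bractE v f n : bract v f n = ev2 v f (br n).
Proof. by []. Qed.

Lemma lactA f g v : lact f (lact g v) = lact (conv f g) v.
Proof.
apply: dual_eq => n; rewrite !lactE.
by have := teq3_ev f g v (bl_assoc n); rewrite ev3_lft ev3_rgt.
Qed.

Lemma bractA v f g : bract (bract v f) g = bract v (conv f g).
Proof. exact: (ractA (M := right_comod)). Qed.

Lemma lact_bract f v g : bract (lact f v) g = lact f (bract v g).
Proof.
apply: dual_eq => n; rewrite bractE lactE.
by have := teq3_ev f v g (b_compat n); rewrite ev3_lft ev3_rgt.
Qed.

Lemma lact_eps v : lact eps v = v.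
Proof.
by apply: dual_eq => n; rewrite lactE -dual_contractl [contractl _ _]bl_counit.
Qed.

End Bicomodule.

(** * The trivial extension coalgebra *)

Section TrivialExtension.
Variables (k : fieldType) (C : coalgebra k) (N : bicomod C).
Let E : lmodType k := (C * N)%type.

Let inC (c : C) : E := (c, 0).
Let inN (n : N) : E := (0, n).

Let inC_lin : linmap inC.
Proof. by move=> a x y; rewrite /inC; congr pair => /=; rewrite scaler0 addr0. Qed.

Let inN_lin : linmap inN.
Proof. by move=> a x y; rewrite /inN; congr pair => /=; rewrite scaler0 addr0. Qed.

Let onC (a : dual E) := pullback inC_lin a.
Let onN (a : dual E) := pullback inN_lin a.

Let dual_split (a : dual E) e : a e = onC a e.1 + onN a e.2.
Proof.
rewrite -[RHS]/(a (inC e.1) + a (inN e.2)) -dualD; congr (a _).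
by case: e => c n; congr pair => /=; rewrite ?addr0 ?add0r.
Qed.

(** Dual to a square-zero extension: there is no component in [N (x) N]. *)
Definition ext_cop (e : E) : seq (E * E) :=
  map2 inC inC (cop e.1) ++ map2 inC inN (bl e.2) ++ map2 inN inC (br e.2).

Definition ext_cou (e : E) : k := cou e.1.

Let ev2_ext (a b : E -> k) e : ev2 a b (ext_cop e) =
  ev2 (a \o inC) (b \o inC) (cop e.1) +
  (ev2 (a \o inC) (b \o inN) (bl e.2) + ev2 (a \o inN) (b \o inC) (br e.2)).
Proof. by rewrite !ev2_cat !ev2_map2. Qed.

Let ev2_extE (a b : dual E) e : ev2 a b (ext_cop e) =
  conv (onC a) (onC b) e.1 +
  (lact (onC a) (onN b) e.2 + bract (onN a) (onC b) e.2).
Proof. exact: ev2_ext. Qed.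

Let ext_cop_lin : lin_up2 ext_cop.
Proof.
apply: lin_up2P => a b c x y; rewrite !ev2_extE.
rewrite -[(c *: x + y).1]/(c *: x.1 + y.1) -[(c *: x + y).2]/(c *: x.2 + y.2).
rewrite (dualP (conv _ _)) (dualP (lact _ _)) (dualP (bract _ _)) !mulrDr.
by rewrite [X in _ + X = _]addrACA [LHS]addrACA.
Qed.

Let ext_cou_lin : linf ext_cou.
Proof. by move=> a x y; exact: cou_lin. Qed.

Let ext_conv (a b : dual E) : dual E := Dual (linf_lin_up2 a b ext_cop_lin).

Let onC_conv a b : onC (ext_conv a b) = conv (onC a) (onC b).
Proof. by apply: dual_eq => c; rewrite /= ev2_extE !dual0 !addr0. Qed.

Let onN_conv a b n :
  onN (ext_conv a b) n = lact (onC a) (onN b) n + bract (onN a) (onC b) n.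
Proof. by rewrite /= ev2_extE !dual0 add0r. Qed.

(** On forms, the [C] component is associativity of convolution, and the [N] component consists of
    the three bimodule laws. *)
Let ext_coassoc e : teq3 (lft ext_cop (ext_cop e)) (rgt ext_cop (ext_cop e)).
Proof.
apply: teq3P => a b c; rewrite ev3_lft ev3_rgt.
rewrite [LHS](ev2_extE (ext_conv a b) c) [RHS](ev2_extE a (ext_conv b c)).
rewrite !onC_conv convA lactE bractE.
rewrite lactE bractE.
rewrite (eq_ev2 _ (onN_conv a b) (frefl _)) (eq_ev2 _ (frefl _) (onN_conv b c)).
rewrite ev2Dl ev2Dr -!lactE -!bractE lactA bractA lact_bract.
by rewrite !addrA.
Qed.

Let ext_counitl e : \sum_(x <- ext_cop e) ext_cou x.1 *: x.2 = e.
Proof.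
apply: dual_inj => a; rewrite [LHS](dual_contractl (Dual ext_cou_lin) a) ev2_extE.
rewrite (_ : onC (Dual ext_cou_lin) = eps); last exact: dual_eq.
rewrite conv_epsl lact_eps bractE /ev2 big1 ?addr0 -?dual_split // => x _.
by rewrite /= /ext_cou linf0 ?mul0r //; exact: cou_lin.
Qed.

Let ext_counitr e : \sum_(x <- ext_cop e) ext_cou x.2 *: x.1 = e.
Proof.
apply: dual_inj => a; rewrite [LHS](dual_contractr a (Dual ext_cou_lin)) ev2_extE.
rewrite (_ : onC (Dual ext_cou_lin) = eps); last exact: dual_eq.
rewrite conv_epsr [bract _ _]ract_eps lactE /ev2 big1 ?add0r -?dual_split //.
by move=> x _; rewrite /= /ext_cou linf0 ?mulr0 //; exact: cou_lin.
Qed.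

Definition trivial_extension : coalgebra k :=
  Coalgebra ext_cop_lin ext_cou_lin ext_coassoc ext_counitl ext_counitr.

Lemma ext_fst_hom : is_coalg_hom (fst : trivial_extension -> C).
Proof.
split=> // e; apply: teq2P => f g; rewrite ev2_map2 [RHS]ev2_ext /=.
rewrite (_ : ev2 f g (cop e.1) = conv f g e.1) //.
by rewrite /ev2 big1 ?big1 ?addr0 // => x _ /=; rewrite ?dual0 ?mulr0 ?mul0r.
Qed.

Variable gam : dual N.

(* The inner coderivation [N -> C] attached to [gam]. *)
Definition coder (n : N) : C := contractr gam (bl n) - contractl gam (br n).

Lemma dual_coder (f : dual C) n : f (coder n) = lact f gam n - bract gam f n.
Proof. by rewrite dualB dual_contractr dual_contractl. Qed.

Lemma coder_lin : linmap coder.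
Proof.
move=> a x y; apply: dual_inj => f; rewrite (dualP f) !dual_coder.
by rewrite (dualP (lact _ _)) (dualP (bract _ _)) mulrBr opprD addrACA.
Qed.

(** Dually, [f] goes to the pair of [f] and the commutator [lact f gam - bract gam f]. An inner
    derivation satisfies the Leibniz rule, as the mixed terms [f gam g] cancel, and it kills
    [eps]. *)
Lemma ext_shear_hom :
  is_coalg_hom ((fun e => e.1 + coder e.2) : trivial_extension -> C).
Proof.
pose h (e : E) : C := e.1 + coder e.2.
have lh : linmap h.
  move=> a x y; rewrite /h [coder _]coder_lin (scalerDr a x.1).
  by rewrite [RHS]addrACA.
split=> //.
  move=> e; apply: teq2P => f g; rewrite ev2_map2.
  rewrite [RHS](ev2_extE (pullback lh f) (pullback lh g)).
  have hC l : onC (pullback lh l) = l.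
    by apply: dual_eq => c; rewrite /= /h (linmap0 coder_lin) addr0.
  have hN l n : onN (pullback lh l) n = lact l gam n - bract gam l n.
    by rewrite /= /h add0r dual_coder.
  rewrite !hC (lactE f) bractE.
  rewrite (eq_ev2 _ (hN f) (frefl _)) (eq_ev2 _ (frefl _) (hN g)).
  rewrite ev2Bl ev2Br -!lactE -!bractE -convE dualD dual_coder.
  by rewrite lactA bractA lact_bract; congr (_ + _); rewrite addrA subrK.
move=> e; rewrite -[LHS]/(eps (h e)) dualD dual_coder lact_eps.
by rewrite [bract _ _]ract_eps subrr addr0.
Qed.

End TrivialExtension.

Lemma mono_same_H0 (k : fieldType) (C D : coalgebra k) (phi : C -> D) :
  is_coalg_hom phi -> monomorphism phi -> same_H0 phi.
Proof.
move=> hphi mono N gam0 lgam; pose gam := Dual lgam.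
have lphi := hom_linmap hphi.
have phil n : \sum_(x <- bl n) gam0 x.2 *: phi x.1 = phi (contractr gam (bl n)).
  by rewrite linmap_sum //; apply: eq_bigr => x _; rewrite linmapZ.
have phir n : \sum_(x <- br n) gam0 x.1 *: phi x.2 = phi (contractl gam (br n)).
  by rewrite linmap_sum //; apply: eq_bigr => x _; rewrite linmapZ.
split=> H n; first by rewrite phil phir; congr phi; exact: H.
have coder0 m : phi (coder gam m) = 0.
  apply: dual_inj => f; rewrite dual0 -[LHS]/(pullback lphi f _) dualB /=.
  by rewrite -phil -phir H subrr.
have eqphi (e : trivial_extension N) : phi e.1 = phi (e.1 + coder gam e.2).
  by rewrite (linmapD lphi) coder0 addr0.
(* At [(0, n)] the two maps take the values [0] and [coder gam n]. *)
have := mono _ _ _ (ext_fst_hom N) (ext_shear_hom gam) eqphi (0, n).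
by rewrite /= add0r => /esym/subr0_eq.
Qed.

(** * The bicomodule C []_D C *)

Section CotensorModule.
Variables (k : fieldType) (C D : coalgebra k) (phi : C -> D).
Variable hphi : is_coalg_hom phi.

Local Notation "f ^phi" := (pullback (hom_linmap hphi) f)
  (at level 2, format "f ^phi").

(* Elements of [C (x) C] are represented by their values on [C^* x C^*]. *)
Definition form2 := dual C * dual C -> k^o.
HB.instance Definition _ := GRing.Lmodule.on form2.

Definition tensor_form (t : seq (C * C)) : form2 := fun p => ev2 p.1 p.2 t.

(** The cotensor condition as in [cotensor_regularP]; it depends only on [tensor_form t]. *)
Definition balanced (t : seq (C * C)) :=
  forall (f : dual C) (g : dual D) (h : dual C),
    ev2 (conv f g^phi) h t = ev2 f (conv g^phi h) t.

Definition cot_pred : {pred form2} :=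
  [pred F | `[< exists2 t, balanced t & F = tensor_form t >]].

Lemma cot_predP F :
  reflect (exists2 t, balanced t & F = tensor_form t) (F \in cot_pred).
Proof. exact: asboolP. Qed.

Lemma cot_pred_submod : submod_closed cot_pred.
Proof.
split=> [|a F G /cot_predP[t bt ->] /cot_predP[s bs ->]]; apply/cot_predP.
  exists [::]; first by move=> f g h; rewrite !ev2_nil.
  by apply/funext => p; rewrite /tensor_form ev2_nil.
exists (scale2 a t ++ s); first by move=> f g h; rewrite !ev2_cat !ev2_scale2 bt bs.
by apply/funext => p; rewrite /tensor_form ev2_cat ev2_scale2.
Qed.

HB.instance Definition _ := GRing.isSubmodClosed.Build k form2 cot_pred
  (GRing.submod_closed_semi cot_pred_submod).

Record cot := Cot { cot_val : form2; _ : cot_val \in cot_pred }.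
HB.instance Definition _ := [isSub for cot_val].
HB.instance Definition _ := [Choice of cot by <:].
HB.instance Definition _ := [SubChoice_isSubLmodule of cot by <:].

Lemma cot_eq (x y : cot) :
  (forall f g, cot_val x (f, g) = cot_val y (f, g)) -> x = y.
Proof. by move=> xy; apply: val_inj; apply/funext => -[f g]; exact: xy. Qed.

Lemma cot_valP (a : k) (x y : cot) p :
  cot_val (a *: x + y) p = a * cot_val x p + cot_val y p.
Proof. by rewrite -[cot_val _]/(val _) GRing.valD GRing.valZ. Qed.

Lemma cot_val_sum (I : Type) (r : seq I) (F : I -> cot) p :
  cot_val (\sum_(i <- r) F i) p = \sum_(i <- r) cot_val (F i) p.
Proof.
apply: (big_morph (fun x => cot_val x p)) => [x y|//].
by rewrite -[x in LHS]scale1r cot_valP mul1r.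
Qed.

Lemma cot_valZ (a : k) (x : cot) p : cot_val (a *: x) p = a * cot_val x p.
Proof. by rewrite -[cot_val _]/(val _) GRing.valZ. Qed.

(** On tensors this contracts the first leg of the coproduct of the left factor by [f]; balance
    survives by associativity of convolution. *)
Lemma ltrans_pred (f : dual C) (x : cot) :
  (fun p => cot_val x (conv f p.1, p.2)) \in cot_pred.
Proof.
case: x => F /= /cot_predP[t bt ->]; apply/cot_predP.
pose s := map2 (fun c : C => contractl f (cop c)) id t.
have sE (g h : dual C) : ev2 g h s = ev2 (conv f g) h t.
  by rewrite ev2_map2; apply: eq_ev2 => // c; rewrite /= dual_contractl.
exists s; first by move=> g h l; rewrite !sE -convA bt.
by apply/funext => p; rewrite /tensor_form sE.
Qed.

Definition ltrans f x : cot := Cot (ltrans_pred f x).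

Lemma rtrans_pred (f : dual C) (x : cot) :
  (fun p => cot_val x (p.1, conv p.2 f)) \in cot_pred.
Proof.
case: x => F /= /cot_predP[t bt ->]; apply/cot_predP.
pose s := map2 id (fun c : C => contractr f (cop c)) t.
have sE (g h : dual C) : ev2 g h s = ev2 g (conv h f) t.
  by rewrite ev2_map2; apply: eq_ev2 => // c; rewrite /= dual_contractr.
exists s; first by move=> g h l; rewrite !sE convA bt.
by apply/funext => p; rewrite /tensor_form sE.
Qed.

Definition rtrans f x : cot := Cot (rtrans_pred f x).

Lemma ltrans_lin f : linmap (ltrans f).
Proof. by move=> a x y; apply: cot_eq => g h; rewrite [RHS]cot_valP; exact: cot_valP. Qed.

Lemma rtrans_lin f : linmap (rtrans f).
Proof. by move=> a x y; apply: cot_eq => g h; rewrite [RHS]cot_valP; exact: cot_valP. Qed.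

(** The order is reversed because a left coaction corresponds to a right action of the dual
    algebra. *)
Lemma ltransA f g x : ltrans g (ltrans f x) = ltrans (conv f g) x.
Proof. by apply: cot_eq => p q; rewrite /= convA. Qed.

Lemma rtransA f g x : rtrans f (rtrans g x) = rtrans (conv f g) x.
Proof. by apply: cot_eq => p q; rewrite /= convA. Qed.

Lemma ltrans_rtrans f g x : ltrans f (rtrans g x) = rtrans g (ltrans f x).
Proof. by apply: cot_eq. Qed.

Lemma ltrans_eps x : ltrans eps x = x.
Proof. by apply: cot_eq => p q; rewrite /= conv_epsl. Qed.

Lemma rtrans_eps x : rtrans eps x = x.
Proof. by apply: cot_eq => p q; rewrite /= conv_epsr. Qed.

(* Expanding [f] in coordinates over the finitely many tensor factors that
   occur turns [ltrans f x] into a finite sum, i.e. gives the left coaction. *)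
Lemma left_coaction (x : cot) : exists s : seq (C * cot),
  forall f : dual C, contractl f s = ltrans f x.
Proof.
case: x => F Fx; have /cot_predP[t _ FE] := Fx.
have [s sP] := finite_coords (flatten [seq unzip1 (cop y.1) | y <- t]).
exists [seq (e.1, ltrans e.2 (Cot Fx)) | e <- s] => f.
apply: cot_eq => g h; rewrite cot_val_sum big_map.
transitivity (\sum_(e <- s) \sum_(y <- t)
    f e.1 * (conv (e.2 : dual C) g y.1 * h y.2)).
  by apply: eq_bigr => e _; rewrite cot_valZ /= FE /tensor_form /ev2 mulr_sumr.
rewrite /= FE exchange_big /=; apply: eq_big_seq => y yt.
under eq_bigr do rewrite mulrA.
rewrite -mulr_suml; congr (_ * _); rewrite convE.
rewrite (ev2_coords f g (s := s)) //.
move=> c cy; apply: sP; apply/flattenP; exists (unzip1 (cop y.1)) => //.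
exact: (map_f (fun y => unzip1 (cop y.1))).
Qed.

Lemma right_coaction (x : cot) : exists s : seq (cot * C),
  forall f : dual C, contractr f s = rtrans f x.
Proof.
case: x => F Fx; have /cot_predP[t _ FE] := Fx.
(* The swap is there because [ev2_coords] expands left factors only. *)
pose sw (u : seq (C * C)) := [seq (y.2, y.1) | y <- u].
have [s sP] := finite_coords (flatten [seq unzip1 (sw (cop y.2)) | y <- t]).
exists [seq (rtrans e.2 (Cot Fx), e.1) | e <- s] => f.
have ev_sw (g h : dual C) u : ev2 h g (sw u) = ev2 g h u.
  by rewrite /ev2 big_map; apply: eq_bigr => y _; rewrite mulrC.
apply: cot_eq => g h; rewrite cot_val_sum big_map.
transitivity (\sum_(e <- s) \sum_(y <- t)
    f e.1 * (g y.1 * conv h (e.2 : dual C) y.2)).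
  by apply: eq_bigr => e _; rewrite cot_valZ /= FE /tensor_form /ev2 mulr_sumr.
rewrite /= FE exchange_big /=; apply: eq_big_seq => y yt.
under eq_bigr do rewrite mulrCA.
rewrite -mulr_sumr; congr (_ * _); rewrite convE -ev_sw.
rewrite (ev2_coords f h (s := s)).
  by apply: eq_bigr => e _; rewrite ev_sw.
move=> c cy; apply: sP; apply/flattenP; exists (unzip1 (sw (cop y.2))) => //.
exact: (map_f (fun y => unzip1 (sw (cop y.2)))).
Qed.

(** By [cblE] and [teq2P] the tensor does not depend on the list chosen, which makes the coaction
    linear although the choice is not. *)
Let cbl (x : cot) := projT1 (cid (left_coaction x)).
Let cbr (x : cot) := projT1 (cid (right_coaction x)).

Let cblE (f : dual C) (v : dual cot) x : ev2 f v (cbl x) = v (ltrans f x).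
Proof. by rewrite -dual_contractl /cbl; case: cid => /= s ->. Qed.

Let cbrE (v : dual cot) (f : dual C) x : ev2 v f (cbr x) = v (rtrans f x).
Proof. by rewrite -dual_contractr /cbr; case: cid => /= s ->. Qed.

Let cbl_lin : lin_up2 cbl.
Proof. by apply: lin_up2P => f v a x y; rewrite !cblE ltrans_lin dualP. Qed.

Let cbr_lin : lin_up2 cbr.
Proof. by apply: lin_up2P => f v a x y; rewrite !cbrE rtrans_lin dualP. Qed.

Let cbl_assoc x : teq3 (rgt cbl (cbl x)) (lft (@cop _ C) (cbl x)).
Proof.
apply: teq3P => f g v; rewrite ev3_lft ev3_rgt.
rewrite (eq_ev2 _ (frefl f) (cblE g v)) [LHS](cblE f (pullback (ltrans_lin g) v)).
by rewrite [RHS](cblE (conv f g) v) -ltransA.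
Qed.

Let cbr_assoc x : teq3 (lft cbr (cbr x)) (rgt (@cop _ C) (cbr x)).
Proof.
apply: teq3P => v f g; rewrite ev3_lft ev3_rgt.
rewrite (eq_ev2 _ (cbrE v f) (frefl g)) [LHS](cbrE (pullback (rtrans_lin f) v) g).
by rewrite [RHS](cbrE v (conv f g)) -rtransA.
Qed.

Let cb_compat x : teq3 (lft cbl (cbr x)) (rgt cbr (cbl x)).
Proof.
apply: teq3P => f v g; rewrite ev3_lft ev3_rgt.
rewrite (eq_ev2 _ (cblE f v) (frefl g)) (eq_ev2 _ (frefl f) (cbrE v g)).
rewrite [LHS](cbrE (pullback (ltrans_lin f) v) g) /= ltrans_rtrans.
by rewrite [RHS](cblE f (pullback (rtrans_lin g) v)).
Qed.

Let cbl_counit x : \sum_(y <- cbl x) cou y.1 *: y.2 = x.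
Proof.
by apply: dual_inj => v; rewrite [LHS](dual_contractl eps v) cblE ltrans_eps.
Qed.

Let cbr_counit x : \sum_(y <- cbr x) cou y.2 *: y.1 = x.
Proof.
by apply: dual_inj => v; rewrite [LHS](dual_contractr v eps) cbrE rtrans_eps.
Qed.

Definition cotensor_bicomod : bicomod C :=
  BiComod cbl_lin cbr_lin cbl_assoc cbl_counit cbr_assoc cbr_counit cb_compat.

(** Contracting the left and right coactions of [x] by [gam] and testing with [f] gives the values
    of [x] at [(f, eps)] and [(eps, f)]; their equality for all [f] is (7). *)
Lemma same_H0_symmetric_counit : same_H0 phi -> symmetric_counit phi.
Proof.
move=> H0 t /(cotensor_regularP hphi) bt.
have tP : tensor_form t \in cot_pred by apply/cot_predP; exists t.
have gamL : linf (fun x : cotensor_bicomod => cot_val x (eps, eps)).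
  by move=> a x y; exact: cot_valP.
pose gam := Dual gamL.
have blE f x : ev2 (f : dual C) gam (cbl x) = cot_val x (f, eps).
  by rewrite cblE /= conv_epsr.
have brE f x : ev2 gam (f : dual C) (cbr x) = cot_val x (eps, f).
  by rewrite cbrE /= conv_epsl.
have phiD := hom_linmap hphi.
have [_ H] := H0 cotensor_bicomod gam gamL.
apply: dual_inj => f.
rewrite [LHS](dual_contractl eps f) [RHS](dual_contractr f eps).
rewrite -[LHS]/(cot_val (Cot tP) (eps, f)) -[RHS]/(cot_val (Cot tP) (f, eps)).
rewrite -blE -brE -dual_contractl -dual_contractr; congr (f _).
apply/esym/H => x; apply: dual_inj => g.
transitivity (ev2 g^phi gam (cbl x)).
  by rewrite dual_sum; apply: eq_bigr => y _; rewrite dualZ mulrC.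
transitivity (ev2 gam g^phi (cbr x)); last first.
  by rewrite dual_sum; apply: eq_bigr => y _; rewrite dualZ.
(* For a form pulled back from [D] the two values agree by balance with [eps] in both outer
   places. *)
rewrite blE brE; case: x => F /= Fx; have /cot_predP[s bs ->] := Fx.
rewrite -[LHS]/(ev2 g^phi eps s) -[RHS]/(ev2 eps g^phi s).
by rewrite -[in LHS](conv_epsl g^phi) bs conv_epsr.
Qed.

End CotensorModule.

Theorem theorem2p1 (k : fieldType) (C D : coalgebra k) (phi : C -> D)
  (hphi : is_coalg_hom phi) :
  [<->
   (* 1. phi is a monomorphism of coalgebras *)
   (forall (E : coalgebra k) (f g : E -> C),
      is_coalg_hom f -> is_coalg_hom g ->
      (forall e, phi (f e) = phi (g e)) -> forall e, f e = g e);
   (* 2. the corestriction functor M^C -> M^D is full *)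
   (forall (M N : rcomod C) (f : M -> N), linmap f ->
      (forall m, teq2 (@rcoD _ _ _ phi N (f m)) (map2 f id (@rcoD _ _ _ phi M m))) ->
      forall m, teq2 (rco (f m)) (map2 f id (rco m)));
   (* 3. C []_D Ker(phi) = 0 *)
   (forall t : seq (C * C), all (fun x => phi x.2 == 0) t ->
      cotensor (CrD phi) (ClD phi) t -> teq2 t [::]);
   (* 4. Delta_C : C -> C []_D C is surjective *)
   (forall t : seq (C * C), cotensor (CrD phi) (ClD phi) t ->
      exists c : C, teq2 (cop c) t);
   (* 5. the unit eta_M = rho_M : M -> M []_D C is an isomorphism for all M *)
   (forall M : rcomod C,
      (forall m m' : M, teq2 (rco m) (rco m') -> m = m') /\
      (forall t : seq (M * C), cotensor (@rcoD _ _ _ phi M) (ClD phi) t ->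
         exists m : M, teq2 (rco m) t));
   (* 6. H^0(N,C) = H^0(N,D) for every (C,C)-bicomodule N *)
   (forall (N : bicomod C) (gam : N -> k), linf gam ->
      ((forall n : N, \sum_(x <- bl n) gam x.2 *: x.1
                      = \sum_(x <- br n) gam x.1 *: x.2) <->
       (forall n : N, \sum_(x <- bl n) gam x.2 *: phi x.1
                      = \sum_(x <- br n) gam x.1 *: phi x.2)));
   (* 7. sum eps(a_i) b_i = sum a_i eps(b_i) on C []_D C *)
   (forall t : seq (C * C), cotensor (CrD phi) (ClD phi) t ->
      \sum_(x <- t) cou x.1 *: x.2 = \sum_(x <- t) cou x.2 *: x.1)].
Proof.
have i16 := mono_same_H0 hphi.
have i67 := same_H0_symmetric_counit hphi.
have i75 := symmetric_counit_iso_unit hphi.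
have i54 := @iso_unit_surjective_cop _ _ _ phi.
have i47 := @surjective_cop_symmetric_counit _ _ _ phi.
have i43 := surjective_cop_trivial_cotensor_ker hphi.
have i34 := trivial_cotensor_ker_surjective_cop hphi.
have i52 := iso_unit_full_corestriction hphi.
have i21 := @full_corestriction_mono _ _ _ phi.
(* The goals follow the order of the list cyclically, so the implications, proved along another
   route, are composed. *)
tfae.
- by move/i16/i67/i75/i52.
- by move/i21/i16/i67/i75/i54/i43.
- exact: i34.
- by move/i47/i75.
- by move/i52/i21/i16.
- exact: i67.
- by move/i75/i52/i21.
Qed.
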